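(* Let $n$ and $s$ be positive integers and let $\mathcal{F} \subset \mathbb{S}^{n-1}$ be a spherical $s$-distance set in $\mathbb{R}^n$, with set of inner products $\mathcal{P}(\mathcal{F}) = \{\langle x, y\rangle \mid x, y \in \mathcal{F},\ x \neq y\} = \{t_1, \dots, t_s\}$ (where $t_1,\dots,t_s$ are the $s$ distinct values). If $t_1 + \dots + t_s = 0$, then $$|\mathcal{F}| \le \binom{n+s-1}{s} + \binom{n+s-4}{s-3}.$$
   Context: $\mathbb{R}^n$ carries the standard inner product $\langle\cdot,\cdot\rangle$ and the Euclidean norm $\|\cdot\|$, and $\mathbb{S}^{n-1}$ is the unit sphere centered at the origin in $\mathbb{R}^n$. A finite subset $\mathcal{F} \subset \mathbb{R}^n$ is an $s$-distance set if the set $\mathcal{D}(\mathcal{F}) = \{\|x-y\| \mid x,y\in\mathcal{F},\ x\neq y\}$ has cardinality exactly $s$. It is a spherical $s$-distance set if moreover $\mathcal{F}\subset\mathbb{S}^{n-1}$. For a spherical $s$-distance set, $\mathcal{D}(\mathcal{F})$ is in bijection with $\mathcal{P}(\mathcal{F})$ (since $\|x-y\|^2 = 2-2\langle x,y\rangle$ on the unit sphere), so $\mathcal{P}(\mathcal{F})$ also has exactly $s$ elements. Convention: a binomial coefficient $\binom{a}{b}$ with $b<0$ is $0$ (so the second term vanishes when $s\le 2$). *)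

(* Defs.v *)
From HB Require Import structures.
From mathcomp Require Import all_boot all_order all_algebra.
From mathcomp Require Import finmap reals.

Set Implicit Arguments.
Unset Strict Implicit.
Unset Printing Implicit Defensive.

Import Order.TTheory GRing.Theory Num.Theory.

Local Open Scope fset_scope.
Local Open Scope ring_scope.

Section SphericalDistanceSets.
Context {R : realType} {n : nat}.
Implicit Types (x y : 'rV[R]_n) (F : {fset 'rV[R]_n}).

Definition dotp x y : R := \sum_(i < n) x ord0 i * y ord0 i.

(* Not `|x|, which on matrices denotes the sup norm in MathComp-Analysis. *)
Definition enorm x : R := Num.sqrt (dotp x x).

Definition distances F : {fset R} :=
  [fset enorm (x - y) | x in F, y in F `\ x].

Definition inner_products F : {fset R} :=
  [fset dotp x y | x in F, y in F `\ x].

Definition distance_set (s : nat) F : Prop := #|` distances F| = s.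

Definition spherical_distance_set (s : nat) F : Prop :=
  distance_set s F /\ (forall x, x \in F -> enorm x = 1).

End SphericalDistanceSets.

(* Main.v *)
(** The polynomials [y |-> p <x, y>], [x \in F], with [p] the monic polynomial whose
    roots are the inner products of [F], take nonzero values exactly on the diagonal
    of [F * F], so they are linearly independent as functions on [F].  Since the
    roots sum to [0], [p] has no term of degree [s - 1]; on the sphere, multiplying
    by powers of [<y, y> = 1] makes the terms of degree [s], [s - 2], ... homogeneous
    of degree [s], and those of degree [s - 3], [s - 5], ... homogeneous of degree
    [s - 3].  Counting monomials of degrees [s] and [s - 3] bounds the rank. *)

Require Import Defs.
From mathcomp Require Import all_boot all_order all_algebra.
From mathcomp Require Import finmap reals.
From mathcomp Require Import ring zify.

Import Order.TTheory GRing.Theory Num.Theory.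

Local Open Scope fset_scope.
Local Open Scope ring_scope.

Lemma dotp_ge0 (R : realType) n (x : 'rV[R]_n) : 0 <= dotp x x.
Proof. by apply: sumr_ge0 => i _; rewrite -expr2 sqr_ge0. Qed.

Lemma dotp_eq0 (R : realType) n (x : 'rV[R]_n) : dotp x x = 0 -> x = 0.
Proof.
move=> x0; apply/rowP => i; rewrite mxE.
have x_ge0 (j : 'I_n) : true -> 0 <= x ord0 j * x ord0 j by rewrite -expr2 sqr_ge0.
by have /eqP := psumr_eq0P x_ge0 x0 (i := i) isT; rewrite mulf_eq0 orbb => /eqP.
Qed.

Lemma dotpBB (R : realType) n (x y : 'rV[R]_n) :
  dotp (x - y) (x - y) = dotp x x + dotp y y - 2 * dotp x y.
Proof.
rewrite /dotp mulr_sumr -big_split /= -sumrB.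
by apply: eq_bigr => i _; rewrite !mxE; ring.
Qed.

Lemma enorm1_dotp (R : realType) n (x : 'rV[R]_n) : enorm x = 1 -> dotp x x = 1.
Proof. by move=> x1; rewrite -(sqr_sqrtr (dotp_ge0 _ _ x)) [Num.sqrt _]x1 expr1n. Qed.

Lemma enormB_sphere (R : realType) n (x y : 'rV[R]_n) :
  enorm x = 1 -> enorm y = 1 -> enorm (x - y) = Num.sqrt (2 - 2 * dotp x y).
Proof. by move=> /enorm1_dotp x1 /enorm1_dotp y1; rewrite /enorm dotpBB x1 y1. Qed.

(** On the sphere the squared norm of x - y is 2 (1 - <x, y>), and it is nonnegative. *)
Lemma dotp_sphere_le1 (R : realType) n (x y : 'rV[R]_n) :
  enorm x = 1 -> enorm y = 1 -> dotp x y <= 1.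
Proof.
move=> /enorm1_dotp x1 /enorm1_dotp y1; have := dotp_ge0 _ _ (x - y).
rewrite dotpBB x1 y1 (_ : 1 + 1 - _ = 2 * (1 - dotp x y)); last by ring.
by rewrite pmulr_rge0 ?ltr0n // subr_ge0.
Qed.

(** The equality case: an inner product equal to 1 would make the squared norm of x - y vanish. *)
Lemma dotp_sphere_neq1 (R : realType) n (x y : 'rV[R]_n) :
  enorm x = 1 -> enorm y = 1 -> x != y -> dotp x y != 1.
Proof.
move=> /enorm1_dotp x1 /enorm1_dotp y1; apply: contra_neq => xy1.
apply/eqP; rewrite -subr_eq0; apply/eqP/dotp_eq0.
by rewrite dotpBB x1 y1 xy1; ring.
Qed.

Lemma inner_productsP (R : realType) n (F : {fset 'rV[R]_n}) t :
  reflect (exists x y, [/\ x \in F, y \in F, x != y & t = dotp x y])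
    (t \in inner_products F).
Proof.
rewrite /inner_products; apply: (iffP (imfset2P _ _ _ _ _)) => [[x /= xF [y]]|[x [y [xF yF xy ->]]]].
  by rewrite /= !inE => /andP[yx yF] ->; exists x, y; rewrite eq_sym.
by exists x => //; exists y => //=; rewrite !inE eq_sym xy.
Qed.

Lemma card_inner_products (R : realType) n s (F : {fset 'rV[R]_n}) :
  spherical_distance_set s F -> #|` inner_products F| = s.
Proof.
case=> <- F1; pose g (t : R) := Num.sqrt (2 - 2 * t).
have -> : distances F = [fset g t | t in inner_products F].
  apply/fsetP => d; apply/imfset2P/imfsetP => /=.
    case=> x xF [y]; rewrite !inE => /andP[yx yF] ->.
    exists (dotp x y); first by apply/inner_productsP; exists x, y; rewrite eq_sym.
    by rewrite enormB_sphere ?F1.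
  case=> t /inner_productsP[x [y [xF yF xy ->]]] ->.
  exists x => //; exists y; first by rewrite !inE eq_sym xy.
  by rewrite enormB_sphere ?F1.
(* [Num.sqrt] sends every negative number to 0, so injectivity of [g] is only available where its
   radicand is nonnegative. *)
have g_ge0 t : t \in inner_products F -> 0 <= 2 - 2 * t.
  case/inner_productsP=> x [y [/F1 x1 /F1 y1 _ ->]].
  by rewrite subr_ge0 ler_piMr ?ler0n ?dotp_sphere_le1.
rewrite card_in_imfset //= => t u /g_ge0 t0 /g_ge0 u0 /eqP.
rewrite eqr_sqrt // => /eqP/addrI/oppr_inj/mulfI -> //.
by rewrite pnatr_eq0.
Qed.

Section Monomials.
Context {R : realType} {m N : nat} (y : 'I_N -> 'rV[R]_m.+1).

(** Polynomials enter only through their values at the points [y j]: they become row vectors, and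
    the dimension of their span becomes a matrix rank. *)
Definition monomial (r : seq 'I_m.+1) : 'rV[R]_N :=
  \row_j \prod_(a <- r) y j ord0 a.

(* A monomial of degree [d] is encoded by the sorted list of its variables. *)
Definition sorted_tuples d : {set d.-tuple 'I_m.+1} :=
  [set t : d.-tuple 'I_m.+1 | sorted leq [seq val i | i <- t]].

Definition monomial_mx d : 'M[R]_(#|sorted_tuples d|, N) :=
  \matrix_(k < #|sorted_tuples d|) monomial (enum_val k).

Lemma rank_monomial_mx d : (\rank (monomial_mx d) <= 'C(d + m, d))%N.
Proof. by rewrite (leq_trans (rank_leq_row _)) // card_sorted_tuples. Qed.

(** Variables commute, so sorting [r] keeps the product. Later a variable can be prepended without
    maintaining the order. *)
Lemma monomial_sub r : (monomial r <= monomial_mx (size r))%MS.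
Proof.
pose le (a b : 'I_m.+1) := (a <= b)%N.
have sz : size (sort le r) == size r by rewrite size_sort.
have ts : Tuple sz \in sorted_tuples (size r).
  rewrite inE sorted_map; apply: sort_sorted => a b; exact: leq_total.
have -> : monomial r = row (enum_rank_in ts (Tuple sz)) (monomial_mx (size r)).
  rewrite rowK enum_rankK_in //=; apply/rowP => j; rewrite !mxE.
  by apply: perm_big; rewrite perm_sym perm_sort.
exact: row_sub.
Qed.

Lemma monomial_mx_mulX d a (v : 'rV[R]_N) :
  (v <= monomial_mx d)%MS ->
  (\row_j (y j ord0 a * v ord0 j)%R <= monomial_mx d.+1)%MS.
Proof.
case/submxP=> u ->.
have -> : \row_j (y j ord0 a * (u *m monomial_mx d) ord0 j) =
    \sum_k u ord0 k *: monomial (a :: enum_val k).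
  apply/rowP => j; rewrite mxE [in LHS]mxE mulr_sumr summxE.
  by apply: eq_bigr => k _; rewrite !mxE big_cons mulrCA.
apply: summx_sub => k _; apply: scalemx_sub.
by have := monomial_sub (a :: enum_val k); rewrite /= size_tuple.
Qed.

Lemma monomial_mx_mul_dotp d x (v : 'rV[R]_N) :
  (v <= monomial_mx d)%MS ->
  (\row_j (dotp x (y j) * v ord0 j)%R <= monomial_mx d.+1)%MS.
Proof.
move=> vd.
have -> : \row_j (dotp x (y j) * v ord0 j) =
    \sum_a x ord0 a *: \row_j (y j ord0 a * v ord0 j).
  apply/rowP => j; rewrite mxE summxE mulr_suml.
  by apply: eq_bigr => a _; rewrite !mxE mulrA.
by apply: summx_sub => a _; apply/scalemx_sub/monomial_mx_mulX.
Qed.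

Lemma monomial_mx_dotpX x d : (\row_j dotp x (y j) ^+ d <= monomial_mx d)%MS.
Proof.
elim: d => [|d IHd].
  rewrite (_ : \row_j _ = monomial [::]) ?(monomial_sub [::]) //.
  by apply/rowP => j; rewrite !mxE big_nil.
rewrite (_ : \row_j _ = \row_j (dotp x (y j) * (\row_j dotp x (y j) ^+ d) ord0 j)).
  exact: monomial_mx_mul_dotp.
by apply/rowP => j; rewrite !mxE exprS.
Qed.

Hypothesis y_sphere : forall j, dotp (y j) (y j) = 1.

(* On the sphere a polynomial is unchanged by the factor |y|^2. *)
Lemma monomial_mxSS d : (monomial_mx d <= monomial_mx d.+2)%MS.
Proof.
apply/row_subP => k; set v := row k _.
have vd : (v <= monomial_mx d)%MS by exact: row_sub.
have -> : v = \sum_a \row_j (y j ord0 a * (\row_i (y i ord0 a * v ord0 i)) ord0 j).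
  apply/rowP => j; rewrite -[LHS]mul1r -(y_sphere j) summxE mulr_suml.
  by apply: eq_bigr => a _; rewrite !mxE mulrA.
by apply: summx_sub => a _; do 2!apply: monomial_mx_mulX.
Qed.

Lemma monomial_mx_parity d e :
  (d <= e)%N -> odd d = odd e -> (monomial_mx d <= monomial_mx e)%MS.
Proof.
move=> de ode; have -> : e = (d + (e - d)./2.*2)%N.
  by rewrite -[in LHS](subnKC de) -[in LHS](odd_double_half (e - d)) oddB // ode addbb.
elim: _./2 => [|k IHk]; first by rewrite addn0 submx_refl.
by rewrite doubleS !addnS (submx_trans IHk) ?monomial_mxSS.
Qed.

(** The [if] guards against truncated subtraction, which would read [s - 3] as degree 0 when s < 3.
    The matrix [<<_>>] is square, so both branches have the same type. *)
Lemma poly_dotp_sub x (p : {poly R}) s : (size p <= s.+1)%N -> p`_s.-1 = 0 ->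
  (\row_j p.[dotp x (y j)] <=
     monomial_mx s + (if (s < 3)%N then 0 else <<monomial_mx (s - 3)>>))%MS.
Proof.
move=> sp p0.
have -> : \row_j p.[dotp x (y j)] =
    \sum_(k < s.+1) p`_k *: \row_j dotp x (y j) ^+ k.
  apply/rowP => j; rewrite mxE summxE (horner_coef_wide _ sp).
  by apply: eq_bigr => k _; rewrite !mxE.
apply: summx_sub => -[k ks] _ /=.
have [-> |ks1] := eqVneq k s.-1; first by rewrite p0 scale0r sub0mx.
apply: scalemx_sub; apply: submx_trans (monomial_mx_dotpX x k) _.
case: (boolP (odd k == odd s)) => [/eqP oks|oks].
  by apply: submx_trans (addsmxSl _ _); apply: monomial_mx_parity.
(* Here k <= s has parity opposite to s and differs from s - 1, hence k <= s - 3; for s < 3 there is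
   no such k. *)
case: ltnP => s3; first by lia.
apply: submx_trans (addsmxSr _ _); rewrite genmxE.
by apply: monomial_mx_parity; lia.
Qed.

End Monomials.

Theorem theorem3p1 (R : realType) (n s : nat) (F : {fset 'rV[R]_n}) :
  (0 < n)%N -> (0 < s)%N ->
  spherical_distance_set s F ->
  \sum_(t <- inner_products F) t = 0 ->
  (#|` F| <= 'C(n + s - 1, s) + (if s < 3 then 0 else 'C(n + s - 4, s - 3)))%N.
Proof.
case: n F => // m F _ s_gt0 Fs sum0.
have cardP := card_inner_products _ _ _ _ Fs; have [_ F1] := Fs.
set N := #|` F|.
pose y (j : 'I_N) : 'rV[R]_m.+1 := nth 0 (enum_fset F) j.
have yF j : y j \in F by apply: mem_nth.
pose p : {poly R} := \prod_(t <- inner_products F) ('X - t%:P).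
have size_p : size p = s.+1 by rewrite size_prod_XsubC cardP.
have p0 : p`_s.-1 = 0.
  by rewrite -cardP coefPn_prod_XsubC ?sum0 ?oppr0 // cardP -lt0n.
pose G := \matrix_(i, j) p.[dotp (y i) (y j)].
have G_diag i j : i != j -> G i j = 0.
  move=> ij; rewrite mxE; apply/rootP; rewrite root_prod_XsubC.
  apply/inner_productsP; exists (y i), (y j); split => //.
  by rewrite nth_uniq ?fset_uniq.
have rankG : \rank G = N.
  (* Points of the sphere have inner product 1 with themselves, so [G] is p(1) times the
     identity. *)
  have -> : G = diag_mx (const_mx p.[1]).
    apply/matrixP => i j; rewrite [RHS]mxE mxE.
    have [<-|ij] := eqVneq i j; first by rewrite mxE (enorm1_dotp _ _ _ (F1 _ (yF i))).
    by have := G_diag _ _ ij; rewrite mxE.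
  (* It remains that p(1) is nonzero: 1 is not the inner product of two distinct unit vectors. *)
  apply: mxrank_unit; rewrite unitmxE det_diag unitfE prodf_seq_neq0.
  apply/allP => i _; rewrite mxE -/(root p 1) root_prod_XsubC.
  apply/inner_productsP => -[x [z [xF zF xz]]] /esym/eqP; apply/negP.
  by rewrite dotp_sphere_neq1 ?F1.
have y1 j : dotp (y j) (y j) = 1 by rewrite enorm1_dotp ?F1.
have : (G <= monomial_mx y s + (if (s < 3)%N then 0 else <<monomial_mx y (s - 3)>>))%MS.
  apply/row_subP => i; rewrite (_ : row i G = \row_j p.[dotp (y i) (y j)]).
    by apply: poly_dotp_sub; rewrite ?size_p.
  by apply/rowP => j; rewrite !mxE.
move=> /mxrankS; rewrite rankG => /leq_trans; apply.
apply: leq_trans (mxrank_adds_leqif _ _) _; apply: leq_add.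
  (* As n = m + 1, the upper indices n + s - 1 and, for s >= 3, n + s - 4 are d + m for d = s and d
     = s - 3. *)
  by apply: leq_trans (rank_monomial_mx _ _) _; rewrite addnC addSn subn1.
case: ltnP => s3; first by rewrite mxrank0.
rewrite genmxE; apply: leq_trans (rank_monomial_mx _ _) _.
by rewrite (_ : (m.+1 + s - 4 = s - 3 + m)%N) //; lia.
Qed.
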